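(* Let $q$ be a prime power and let $k,k',d,d'$ be positive integers with $q\geq dk+1$, $k'\geq k$, $d'\geq d$ and $q^2\geq d'k'+1$. Let $C_{q,k,d}$ and $C_{q^2,k',d'}$ be the matrices defined in the context. Then there exists a matrix $\mathbf{C}_{q^2,k',d'}$ obtained from $C_{q^2,k',d'}$ by a permutation of rows and a permutation of columns that has the block form \[\mathbf{C}_{q^2,k',d'}=\begin{pmatrix} C_{q,k,d} & Y\\ Z & W\end{pmatrix}\] for some matrices $Y,Z,W$. Moreover, $\mathbf{C}_{q^2,k',d'}$ is the incidence matrix of a $d'$-CFF$((d'k'+1)q^2,\, q^{2(k'+1)})$ and $C_{q,k,d}$ is the incidence matrix of a $d$-CFF$((dk+1)q,\, q^{k+1})$.
   Context: A $d$-CFF$(t,n)$ is a set system $(X,\mathcal{B})$, $|X|=t$, $\mathcal{B}=\{B_1,\dots,B_n\}$, $B_i\subseteq X$, such that no $B_{i_0}\in\mathcal{B}$ is contained in the union of any $d$ other members of $\mathcal{B}$; it is represented by its $t\times n$ binary incidence matrix. For a prime power $r$ with the elements of $\mathbb{F}_r$ listed in a fixed order $x_1,\dots,x_r$, and positive integers $\kappa,\delta$ with $r\ge \delta\kappa+1$, the matrix $C_{r,\kappa,\delta}$ has rows indexed by pairs $(x_i,y)$ with $1\le i\le \delta\kappa+1$ and $y\in\mathbb{F}_r$, columns indexed by polynomials $f\in\mathbb{F}_r[x]$ of degree at most $\kappa$, and entry $1$ iff $f(x_i)=y$ (and $0$ otherwise). The orderings are chosen compatibly: $\mathbb{F}_q$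 is viewed as the subfield of $\mathbb{F}_{q^2}$, and the ordering of $\mathbb{F}_{q^2}$ lists the elements of $\mathbb{F}_q$ first, in the same order used for $\mathbb{F}_q$. *)

(* Defs.v *)
From mathcomp Require Import all_boot all_order all_fingroup all_algebra.

Set Implicit Arguments.
Unset Strict Implicit.
Unset Printing Implicit Defensive.

Definition cover_free (X : finType) (d : nat) (B : {set {set X}}) : Prop :=
  forall (B0 : {set X}) (S : {set {set X}}),
    B0 \in B -> S \subset B :\ B0 -> #|S| = d -> ~~ (B0 \subset cover S).

Definition is_CFF (X : finType) (d t n : nat) (B : {set {set X}}) : Prop :=
  [/\ #|X| = t, #|B| = n & cover_free d B].

(* Rows are the points and columns the blocks, each listed exactly once. *)
Definition incidence_mx (X : finType) (B : {set {set X}}) (t n : nat)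
    (M : 'M[bool]_(t, n)) : Prop :=
  exists (pt : 'I_t -> X) (bl : 'I_n -> {set X}),
    [/\ bijective pt, injective bl, B = [set bl j | j : 'I_n]
      & forall i j, M i j = (pt i \in bl j)].

Definition CFF_incidence_mx (d t n : nat) (M : 'M[bool]_(t, n)) : Prop :=
  exists (X : finType) (B : {set {set X}}), is_CFF d t n B /\ incidence_mx B M.

(* The matrix C_{r,k,d} over F, with evaluation points x_1, ..., x_(d*k+1)
   being the first d*k+1 entries of the listing x of F (0-based here).
   The order in which the row labels (x_i, y) and the column labels f are laid
   out is given by rows and cols, meant to be bijections; {poly_(k+1) F} is the
   type of polynomials of size at most k+1, i.e. of degree at most k. *)
Definition poly_cff_mx (F : finFieldType) (r k d t n : nat) (x : 'I_r -> F)
    (le_r : d * k + 1 <= r) (rows : 'I_t -> 'I_(d * k + 1) * F)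
    (cols : 'I_n -> {poly_(k + 1) F}) : 'M[bool]_(t, n) :=
  \matrix_(i < t, j < n)
    ((cols j).[x (widen_ord le_r (rows i).1)]%R == (rows i).2).

(* Main.v *)
(* The columns of C_{r,k,d} are the graphs of polynomials over dk+1 points.
   Two distinct polynomials of degree at most k agree on at most k points, so d
   other graphs cover at most dk of the dk+1 points of a given graph.
   For the block form, (x_i, y) |-> (x_i, iota y) and f |-> f^iota inject the
   labels of C_{q,k,d} into those of C_{q^2,k',d'} and preserve incidence, since
   f^iota (iota a) = iota (f a); any injection of an initial segment extends to
   a permutation. *)
Require Import Defs.
From mathcomp Require Import all_boot all_order all_fingroup all_algebra.
From mathcomp Require Import primitive_action alt.

Set Implicit Arguments.
Unset Strict Implicit.
Unset Printing Implicit Defensive.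

(** An injection from ['I_a] is a duplicate-free [a]-tuple, and the symmetric group of [T] acts
    transitively on these whenever [a <= #|T|]. *)
Lemma perm_extend (T : finType) (a : nat) (f g : 'I_a -> T) :
  injective f -> injective g -> exists s : {perm T}, forall i, s (g i) = f i.
Proof.
move=> f_inj g_inj; have aT : a <= #|T|.
  by have := leq_card f f_inj; rewrite card_ord.
have dtup h : injective h -> [tuple h i | i < a] \in a.-dtuple([set: T]).
  by move=> h_inj; rewrite inE subset_all map_inj_uniq ?enum_uniq //=; apply/allP.
have := atransP2 (ntransitive_weak aT (Sym_trans T)) (dtup _ g_inj) (dtup _ f_inj).
case=> s _ /(congr1 (fun t => tnth t _)) fgs; exists s => i.
by have := fgs i; rewrite tnth_mktuple [RHS]tnth_map tnth_mktuple => ->.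
Qed.

Lemma card_bigcup_leq_mul (T I : finType) (S : {set I}) (E : I -> {set T}) m :
  (forall i, i \in S -> #|E i| <= m) -> #|\bigcup_(i in S) E i| <= #|S| * m.
Proof.
move=> Em; rewrite -sum_nat_const.
elim/big_ind2: _ => [|m1 A m2 B leA leB|i /Em //]; first by rewrite cards0.
by rewrite (leq_trans (leq_card_setU A B).1) ?leq_add.
Qed.

(** A block [A] inside the union of [d] other blocks would be the union of its [d] traces on them,
    each of at most [k] points, hence too small. *)
Lemma cover_free_small_inter (X : finType) d k (B : {set {set X}}) :
    (forall A, A \in B -> d * k < #|A|) ->
    (forall A A', A \in B -> A' \in B -> A != A' -> #|A :&: A'| <= k) ->
  cover_free d B.
Proof.
move=> B_large B_inter A S AB SB Sd; apply/negP => /setIidPl AS.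
have := B_large A AB; rewrite ltnNge -{1}AS -Sd /cover big_distrr /=.
rewrite card_bigcup_leq_mul // => A' /(subsetP SB).
by rewrite !inE eq_sym => /andP[neqA A'B]; exact: B_inter.
Qed.

Section PolynomialGraphs.

Variables (F : finFieldType) (m n : nat) (x : 'I_m -> F).
Hypothesis x_inj : injective x.

Definition poly_graph (f : {poly F}) : {set 'I_m * F} :=
  [set (i, f.[x i]%R) | i : 'I_m].

Lemma in_poly_graph f z : (z \in poly_graph f) = (f.[x z.1]%R == z.2).
Proof.
apply/imsetP/eqP => [[i _ ->] // | fz]; exists z.1 => //.
by rewrite fz -surjective_pairing.
Qed.

Lemma card_poly_graph f : #|poly_graph f| = m.
Proof. by rewrite card_imset ?card_ord // => i j []. Qed.

(** A common point is determined by its abscissa, which is a root of the nonzero polynomial [f - g].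
    As [n] bounds the size, the degree is at most [n.-1]. *)
Lemma card_poly_graphI (f g : {poly_n F}) :
  f != g -> #|poly_graph f :&: poly_graph g| <= n.-1.
Proof.
move=> neq_fg; set A := _ :&: _; pose h : {poly_n F} := (f - g)%R.
have h_neq0 : (h : {poly F}) != 0%R by rewrite GRing.subr_eq0.
have fst_inj : {in A &, injective (fun z : 'I_m * F => x z.1)}.
  move=> [i y] [j z]; rewrite !inE !in_poly_graph /= => /andP[/eqP <- _].
  by move=> /andP[/eqP <- _] /x_inj ->.
have := max_poly_roots h_neq0 (rs := [seq x z.1 | z <- enum A]).
rewrite size_map -cardE => bound.
have : #|A| < n; last by case: n.
apply: leq_trans (size_npoly h); apply: bound.
  apply/allP => _ /mapP[z + ->]; rewrite mem_enum !inE !in_poly_graph.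
  by case/andP=> /eqP fz /eqP gz; rewrite /root /h /= hornerD hornerN fz gz GRing.subrr.
rewrite map_inj_in_uniq ?enum_uniq // => z w; rewrite !mem_enum.
exact: fst_inj.
Qed.

(** Equal graphs of distinct polynomials would share all [m] points, more than the [n.-1]
    allowed. *)
Lemma poly_graph_inj :
  0 < n <= m -> injective (fun f : {poly_n F} => poly_graph f).
Proof.
move=> /andP[n_gt0 n_le_m] f g eq_fg; apply/eqP; apply: contraT => neq_fg.
have := card_poly_graphI neq_fg; rewrite eq_fg setIid card_poly_graph.
by rewrite leqNgt prednK // n_le_m.
Qed.

End PolynomialGraphs.

Lemma poly_cff_mx_CFF (F : finFieldType) (r k d t n : nat) (x : 'I_r -> F)
    (le_r : d * k + 1 <= r) (rows : 'I_t -> 'I_(d * k + 1) * F)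
    (cols : 'I_n -> {poly_(k + 1) F}) :
    0 < d -> injective x -> bijective rows -> bijective cols ->
  CFF_incidence_mx d (poly_cff_mx x le_r rows cols).
Proof.
move=> d_gt0 x_inj rows_bij cols_bij.
set y := fun i => x (widen_ord le_r i).
have y_inj : injective y by move=> i j /x_inj [] /val_inj.
pose bl j := poly_graph y (cols j).
(* Positivity of [d] ensures enough evaluation points to tell the columns apart, so that the blocks
   are pairwise distinct. *)
have le_k : 0 < k + 1 <= d * k + 1 by rewrite addn1 /= -addn1 leq_add2r leq_pmull.
have bl_inj : injective bl.
  by move=> i j /(poly_graph_inj y_inj le_k) /(bij_inj cols_bij).
exists ('I_(d * k + 1) * F)%type, [set bl j | j : 'I_n]; split; last first.
  by exists rows, bl; split=> // i j; rewrite mxE in_poly_graph.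
split; first by rewrite -(bij_eq_card rows_bij) card_ord.
  by rewrite card_imset // card_ord.
apply: (@cover_free_small_inter _ _ k) => [_ /imsetP[j _ ->]|].
  by rewrite card_poly_graph // addn1.
move=> _ _ /imsetP[i _ ->] /imsetP[j _ ->] neq_ij.
apply: leq_trans (card_poly_graphI y_inj _) _; last by rewrite addn1.
by apply: contraNneq neq_ij => eq_ij; rewrite /bl eq_ij.
Qed.


Theorem theorem3 (p e q : nat) (hp : prime p) (he : 0 < e) (hq : q = p ^ e)
    (k k' d d' : nat) (hk : 0 < k) (hk' : 0 < k') (hd : 0 < d) (hd' : 0 < d')
    (hqdk : d * k + 1 <= q) (hkk' : k <= k') (hdd' : d <= d')
    (hqdk' : d' * k' + 1 <= q ^ 2)
    (* F_q, F_(q^2), and F_q viewed as a subfield of F_(q^2) *)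
    (F K : finFieldType) (hF : #|F| = q) (hK : #|K| = q ^ 2)
    (iota : {rmorphism F -> K})
    (* compatible listings of the two fields *)
    (x : 'I_q -> F) (hx : bijective x)
    (x' : 'I_(q ^ 2) -> K) (hx' : bijective x')
    (hxx' : forall (i : 'I_q) (j : 'I_(q ^ 2)), i = j :> nat -> x' j = iota (x i))
    (* arbitrary orders of the row and column labels of the two matrices *)
    (rows : 'I_((d * k + 1) * q) -> 'I_(d * k + 1) * F)
    (hrows : bijective rows)
    (cols : 'I_(q ^ (k + 1)) -> {poly_(k + 1) F}) (hcols : bijective cols)
    (rows' : 'I_((d' * k' + 1) * q ^ 2) -> 'I_(d' * k' + 1) * K)
    (hrows' : bijective rows')
    (cols' : 'I_(q ^ (2 * (k' + 1))) -> {poly_(k' + 1) K})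
    (hcols' : bijective cols') :
  let C := poly_cff_mx x hqdk rows cols in
  let C' := poly_cff_mx x' hqdk' rows' cols' in
  (exists BC : 'M[bool]_((d' * k' + 1) * q ^ 2, q ^ (2 * (k' + 1))),
    [/\ exists (s : 'S_((d' * k' + 1) * q ^ 2)) (u : 'S_(q ^ (2 * (k' + 1)))),
          BC = row_perm s (col_perm u C'),
        exists (m n : nat)
          (em : (d * k + 1) * q + m = (d' * k' + 1) * q ^ 2)
          (en : q ^ (k + 1) + n = q ^ (2 * (k' + 1)))
          (Y : 'M[bool]_((d * k + 1) * q, n))
          (Z : 'M[bool]_(m, q ^ (k + 1)))
          (W : 'M[bool]_(m, n)),
          BC = castmx (em, en) (block_mx C Y Z W)
      & CFF_incidence_mx d' BC]) /\
  CFF_incidence_mx d C.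
Proof.
move=> C C'.
have x_inj := bij_inj hx; have x'_inj := bij_inj hx'.
split; last exact: poly_cff_mx_CFF.
have le_m : d * k + 1 <= d' * k' + 1 by rewrite leq_add2r leq_mul.
have le_n : k + 1 <= k' + 1 by rewrite leq_add2r.
have [rows_inv rowsK rows_invK] := hrows'.
have [cols_inv colsK cols_invK] := hcols'.
(* [row_of] and [col_of] locate in [C'] the images under [iota] of the labels of [C]. *)
pose row_of i := rows_inv (widen_ord le_m (rows i).1, iota (rows i).2).
pose col_of j := cols_inv (npolyp (k' + 1) (map_poly iota (cols j))).
have col_ofE j : cols' (col_of j) = map_poly iota (cols j) :> {poly K}.
  (* [npolyp] does not alter the polynomial here: [iota] preserves size, and [k <= k']. *)
  rewrite cols_invK npolypK // size_map_poly.
  exact: leq_trans (size_npoly _) le_n.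
have row_inj : injective row_of.
  move=> i j /(can_inj rows_invK) [] eq1 /GRing.fmorph_inj eq2.
  apply: (bij_inj hrows); rewrite (surjective_pairing (rows i)) eq2.
  by rewrite (surjective_pairing (rows j)); congr pair; apply: val_inj.
have col_inj : injective col_of.
  move=> i j /(congr1 (fun l => cols' l : {poly K})).
  rewrite !col_ofE => /map_poly_inj /val_inj; exact: bij_inj.
have le_rows := leq_card row_of row_inj; rewrite !card_ord in le_rows.
have le_cols := leq_card col_of col_inj; rewrite !card_ord in le_cols.
pose em := subnKC le_rows; pose en := subnKC le_cols.
(* The second injection is the initial segment, written with [lshift] and [cast_ord] to match the
   indices of the upper left block. *)
have [s sE] := perm_extend row_inj (inj_comp (@cast_ord_inj _ _ em) (@lshift_inj _ _)).
have [u uE] := perm_extend col_inj (inj_comp (@cast_ord_inj _ _ en) (@lshift_inj _ _)).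
(* Permuting rows and columns merely reorders the labels, so the result is again a [poly_cff_mx] and
   inherits the CFF property. *)
have BCE : row_perm s (col_perm u C')
    = poly_cff_mx x' hqdk' (rows' \o s) (cols' \o u).
  by apply/matrixP => i j; rewrite !mxE.
exists (row_perm s (col_perm u C')); split; first by exists s, u.
- exists _, _, em, en.
  set M := row_perm s (col_perm u C').
  pose N := castmx (esym em, esym en) M.
  exists (ursubmx N), (dlsubmx N), (drsubmx N).
  (* The other three blocks are whatever [N] contains; only the corner has to be identified. *)
  suff -> : C = ulsubmx N by rewrite submxK castmxKV.
  apply/matrixP => i j; rewrite /N [RHS]mxE [in RHS]mxE castmxE !esymK /M BCE !mxE /=.
  have /= -> := sE i; have /= -> := uE j.
  rewrite col_ofE rows_invK /=.
  set l := widen_ord hqdk _.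
  (* Both widenings keep the index of the evaluation point, so compatibility of the listings
     applies; injectivity of [iota] then reflects the incidence back to [F]. *)
  by rewrite (hxx' l) // horner_map (inj_eq (@GRing.fmorph_inj _ _ iota)).
- rewrite BCE; apply: poly_cff_mx_CFF => //.
    exact: bij_comp hrows' (injF_bij (@perm_inj _ s)).
  exact: bij_comp hcols' (injF_bij (@perm_inj _ u)).
Qed.
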